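(* Assume $n\ge5$ and $K>0$. Let $u\in\mathbb{R}^{\Lambda}$, $\Lambda=\mathbb{Z}/n\mathbb{Z}$, be an equilibrium point of the nearest-neighbor Kuramoto model with $1\le p\le n-2$, that is, with at least two of the signs $\sigma_i$ equal to $-1$. Then $u$ is a saddle of Morse index at least $2$, i.e. the Hessian matrix of $U$ at $u$ has at least two strictly negative eigenvalues (counted with multiplicity).
   Context: The potential is $U(u)=-\frac{K}{2\pi}\sum_{i\in\Lambda}\cos(2\pi(u_{i+1}-u_i))$ on $\mathbb{R}^{\Lambda}$, and equilibria are points with $\nabla U(u)=0$, i.e. $\sin(2\pi(u_{i+1}-u_i))=\sin(2\pi(u_i-u_{i-1}))$ for all $i\in\Lambda$. For an equilibrium $u$ put $a_i=(u_{i+1}-u_i)\bmod 1$. Then either all $a_i$ are equal (this case is assigned $p=n$), or the $a_i$ take exactly two different values $a$ and $\hat a=\frac12-a \pmod 1$. In the latter case $\cos(2\pi a)$ and $\cos(2\pi\hat a)$ are nonzero and opposite, and one names the values so that $\cos(2\pi a)>0>\cos(2\pi\hat a)$. One then sets $\sigma_i=1$ if $a_i=a$ and $\sigma_i=-1$ if $a_i=\hat a$, and $p=\#\{i\in\Lambda:a_i=a\}=\#\{i\in\Lambda:\sigma_i=1\}\in\{1,\dots,n-1\}$. The Morse index of a critical point is the number of strictly negative eigenvalues of the Hessian. *)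

(* Defs.v *)
From HB Require Import structures.
From mathcomp Require Import all_boot all_order all_algebra.
From mathcomp Require Import polyrcf.
From mathcomp Require Import all_classical all_reals all_analysis.

Set Implicit Arguments.
Unset Strict Implicit.
Unset Printing Implicit Defensive.

Import Order.TTheory GRing.Theory Num.Theory.
Import numFieldNormedType.Exports.

Local Open Scope ring_scope.

Section Calculus.
Variables (R : realType) (n : nat).
Implicit Types (f : 'rV[R]_n -> R) (u : 'rV[R]_n) (i : 'I_n).

Definition partial_derivative i f : 'rV[R]_n -> R :=
  fun u => 'D_(delta_mx 0 i) f u.

Definition gradient f u : 'rV[R]_n :=
  \row_i partial_derivative i f u.

Definition hessian f u : 'M[R]_n :=
  \matrix_(i, j) partial_derivative i (partial_derivative j f) u.

Definition critical_point f u : Prop := gradient f u = 0.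

(* [rootsR] lists each real root once, so the multiplicities are restored by
   [mup]. *)
Definition num_neg_eigenvalues (A : 'M[R]_n) : nat :=
  \sum_(x <- rootsR (char_poly A) | x < 0) mup x (char_poly A).

Definition morse_index f u : nat := num_neg_eigenvalues (hessian f u).

End Calculus.

(* The sites of Z/nZ are the elements of ['I_n], the successor of [i] modulo [n]
   being [ordS i]. *)
Section Kuramoto.
Variables (R : realType) (n : nat).
Implicit Types (K : R) (u : 'rV[R]_n) (i : 'I_n).

Definition kuramoto_potential K u : R :=
  - (K / (2 * pi)) * \sum_i cos (2 * pi * (u 0 (ordS i) - u 0 i)).

Definition equilibrium K u : Prop := critical_point (kuramoto_potential K) u.

Definition mod1 (x : R) : R := x - (Num.floor x)%:~R.

Definition phase_diff u i : R := mod1 (u 0 (ordS i) - u 0 i).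

(* The value [a] among the phase differences such that [0 < cos (2 * pi * a)].
   It is unambiguous for an equilibrium whose phase differences are not all
   equal, the only case in which it is meant to be used. *)
Definition main_phase u : R :=
  if [pick i | 0 < cos (2 * pi * phase_diff u i)] is Some i
  then phase_diff u i else 0.

Definition sigma u i : int := if phase_diff u i == main_phase u then 1 else -1.

Definition num_plus u : nat :=
  if [forall i, forall j, phase_diff u i == phase_diff u j] then n
  else #|[set i | sigma u i == 1]|.

End Kuramoto.

(* Main.v *)
(** The Hessian form at [u] is [x |-> 2 pi K \sum_k C_k (x_(k+1) - x_k)^2] with
    [C_k = cos (2 pi (u_(k+1) - u_k))].  At an equilibrium all the sines agree, so
    [C_k = c] or [- c] for one [c >= 0]; since the phases are not all equal,
    [c > 0], and every site whose sign is not [1] has [C_k = - c].  Given two such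
    sites [i] and [j], take [x] with increments [s] at [i], [t] at [j] and
    [- (s + t) / (n - 2)] elsewhere: the form is at most
    [2 pi K c ((s + t)^2 / (n - 2) - s^2 - t^2)], which is negative for [n >= 5].
    A symmetric matrix that is negative definite on a plane has at least two
    negative eigenvalues, because otherwise the plane would contain a nonzero
    vector orthogonal to all the negative eigenvectors. *)

Require Import Defs.
From mathcomp Require Import all_boot all_order all_algebra.
From mathcomp Require Import all_classical all_reals all_analysis.
From mathcomp Require Import complex polyrcf ring lra zify.

Set Implicit Arguments.
Unset Strict Implicit.
Unset Printing Implicit Defensive.

Import Order.TTheory GRing.Theory Num.Theory.
Import numFieldNormedType.Exports.

Local Open Scope ring_scope.

(** * Spectral theory: negative eigenvalues of a real symmetric matrix *)

Section NegativeEigenvalues.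
Variable R : realType.
Local Notation C := R[i].
Local Notation toC := (real_complex R).
Local Notation Re := (@complex.Re R).
Local Notation Im := (@complex.Im R).
Local Notation "M ^t*" := (map_mx Num.conj (M^T)) (at level 30).

Lemma Re_mul_real_conj (x : R) (z w : C) :
  Re (z * toC x * Num.conj w) = Re z * x * Re w + Im z * x * Im w.
Proof.
by case: z => a b; case: w => c d; rewrite /= !mulr0 !subr0 !add0r mulrN opprK.
Qed.

(** Since [G] is real, the products of a real part with an imaginary part contribute nothing to the
    real part. This lets a real form be tested on complex vectors, where the eigenvectors live. *)
Lemma Re_hermitian_form m (G : 'M[R]_m) (z : 'rV[C]_m) :
  Re ((z *m map_mx toC G *m z^t*) 0 0) =
  (map_mx Re z *m G *m (map_mx Re z)^T) 0 0 +
  (map_mx Im z *m G *m (map_mx Im z)^T) 0 0.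
Proof.
rewrite !mxE raddf_sum -big_split; apply: eq_bigr => k _ /=.
rewrite !mxE mulr_suml raddf_sum !mulr_suml -big_split; apply: eq_bigr => j _.
by rewrite !mxE; exact: Re_mul_real_conj.
Qed.

(** A real symmetric matrix is Hermitian over [R[i]], so the complex spectral theorem applies and
    its eigenvalues are real; only the eigenbasis [P] stays complex. *)
Lemma real_spectral n (A : 'M[R]_n) : A^T = A ->
  exists (P : 'M[C]_n) (d : 'rV[R]_n),
    P *m P^t* = 1%:M /\ map_mx toC A = P^t* *m map_mx toC (diag_mx d) *m P.
Proof.
move=> symA; set B := map_mx toC A.
have realB : B \is a mxOver Num.real.
  apply/mxOverP => i j; rewrite mxE /=.
  by rewrite CrealE /=; apply/eqP; exact: (conjc_real (A i j)).
have hermB : B \is hermsymmx.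
  apply: realsym_hermsym => //.
  by apply/is_hermitianmxP; rewrite expr0 scale1r map_mx_id // /B map_trmx symA.
have specB := orthomx_spectralP (hermitian_normalmx hermB).
exists (spectralmx B), (map_mx Re (spectral_diag B)).
have PU := spectral_unitarymx B; split; first exact/unitarymxP.
rewrite -invmx_unitary // [LHS]specB; congr (_ *m _ *m _).
rewrite map_diag_mx -map_mx_comp; congr diag_mx; apply/rowP => j; rewrite mxE /=.
have /mxOverP/(_ 0 j) := hermitian_spectral_diag_real hermB.
rewrite CrealE; case: (_ 0 j) => a b /eqP/= [] /eqP.
by rewrite eqNr => /eqP ->.
Qed.

Lemma char_poly_similar (F : comNzRingType) n (P Q D : 'M[F]_n) :
  P *m Q = 1%:M -> char_poly (Q *m D *m P) = char_poly D.
Proof.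
move=> PQ; have QP := mulmx1C PQ; rewrite /char_poly.
have -> : char_poly_mx (Q *m D *m P) =
    map_mx polyC Q *m char_poly_mx D *m map_mx polyC P.
  rewrite /char_poly_mx mulmxBr mulmxBl !map_mxM mul_mx_scalar -scalemxAl.
  by rewrite -[map_mx _ Q *m map_mx _ P]map_mxM QP map_mx1 scalemx1.
rewrite !det_mulmx mulrAC -det_mulmx -[map_mx _ Q *m _]map_mxM.
by rewrite QP map_mx1 det1 mul1r.
Qed.

Lemma num_neg_eigenvalues_prod n (A : 'M[R]_n) (d : 'I_n -> R) :
  char_poly A = \prod_i ('X - (d i)%:P) ->
  num_neg_eigenvalues A = #|[set i | d i < 0]|.
Proof.
move=> eqp; rewrite /num_neg_eigenvalues; set p := char_poly A.
have p0 : p != 0 by rewrite monic_neq0 ?char_poly_monic.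
have mupE x : mup x p = (\sum_i (d i == x))%N.
  rewrite /p eqp -[in LHS](big_map d xpredT (fun y => 'X - y%:P)).
  rewrite mu_prod_XsubC -sum1_count big_map big_mkcond.
  by apply: eq_bigr => i _ /=; case: eqP.
under eq_bigr do rewrite mupE.
(* After exchanging the sums, each [i] is counted over the negative roots equal to [d i]; as
   [rootsR] is duplicate-free, this gives 1 if [d i < 0] and 0 otherwise. *)
rewrite exchange_big /= -sum1_card [RHS]big_mkcond; apply: eq_bigr => i _.
have rd : d i \in rootsR p.
  rewrite -(roots_on_rootsR p0) inE /= /p eqp.
  by rewrite (bigD1 i) //= rootM root_XsubC eqxx.
rewrite big_mkcond (bigD1_seq (d i)) //=; last exact: uniq_roots.
rewrite eqxx inE big1 ?addn0; first by case: ifP.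
by move=> x xd; rewrite eq_sym (negPf xd); case: ifP.
Qed.

Lemma negative_definite_rows_le_num_neg m n (A : 'M[R]_n) (W : 'M[R]_(m, n)) :
  A^T = A ->
  (forall v : 'rV_m, v != 0 -> (v *m (W *m A *m W^T) *m v^T) 0 0 < 0) ->
  (m <= num_neg_eigenvalues A)%N.
Proof.
move=> symA negW; have [P [d [PU specA]]] := real_spectral symA.
have -> : num_neg_eigenvalues A = #|[set i | d 0 i < 0]|.
  apply: num_neg_eigenvalues_prod; apply: (@map_poly_inj _ _ toC).
  rewrite map_char_poly specA char_poly_similar // -map_char_poly.
  rewrite char_poly_trig ?diag_mx_is_trig //; congr (map_poly _ _).
  by apply: eq_bigr => i _; rewrite mxE eqxx.
set N := [set i | _]; rewrite leqNgt; apply/negP => ltNm.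
(* The rows of [Y] are the coordinates of the rows of [W] in the eigenbasis, and [M] keeps those
   along negative eigenvalues. With fewer columns than rows, [M] has a nonzero left kernel. *)
pose Y := map_mx toC W *m P^t*.
pose M : 'M[C]_(m, #|N|) := \matrix_(j, k) Y j (enum_val k).
have : kermx M != 0.
  by rewrite kermx_eq0 /row_free neq_ltn (leq_ltn_trans (rank_leq_col M)).
move=> /rowV0Pn[z /sub_kermxP zM z0].
have zY i : d 0 i < 0 -> (z *m Y) 0 i = 0.
  move=> di; have iN : i \in N by rewrite inE.
  have /rowP/(_ (enum_rank_in iN i)) := zM; rewrite !mxE => h.
  by rewrite -[RHS]h; apply: eq_bigr => j _; rewrite !mxE enum_rankK_in.
have := Re_hermitian_form (W *m A *m W^T) z.
have -> : z *m map_mx toC (W *m A *m W^T) *m z^t* =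
          (z *m Y) *m map_mx toC (diag_mx d) *m (z *m Y)^t*.
  rewrite !map_mxM specA /Y !trmx_mul !map_mxM !mulmxA /= map_trmx.
  have -> : map_mx Num.conj (P^T^t*) = P.
    by apply/matrixP => i j; rewrite !mxE conjCK.
  congr (_ *m _ *m _); apply/matrixP => i j; rewrite !mxE.
  exact/esym/(conjc_real (W j i)).
have diag_ge0 (x : 'rV[R]_n) : (forall i, d 0 i < 0 -> x 0 i = 0) ->
    0 <= (x *m diag_mx d *m x^T) 0 0.
  move=> x0; rewrite mul_mx_diag mxE sumr_ge0 // => i _; rewrite !mxE.
  have [/x0 ->|di] := ltP (d 0 i) 0; first by rewrite mulr0.
  by rewrite mulrAC mulr_ge0 // -expr2 sqr_ge0.
rewrite Re_hermitian_form => eq_forms.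
have : 0 <= (map_mx Re z *m (W *m A *m W^T) *m (map_mx Re z)^T) 0 0 +
            (map_mx Im z *m (W *m A *m W^T) *m (map_mx Im z)^T) 0 0.
  by rewrite -eq_forms addr_ge0 // diag_ge0 // => i /zY zYi; rewrite mxE zYi.
apply/negP; rewrite -ltNge.
(* As [z] is nonzero, its real or imaginary part is nonzero, which makes the sum of the two real
   forms strictly negative. *)
have [Re0|/negW neg_Re] := eqVneq (map_mx Re z) 0.
  rewrite Re0 !mul0mx mxE add0r negW //; apply: contra_neq z0 => Im0.
  apply/rowP => j; move/rowP/(_ j): Re0; move/rowP/(_ j): Im0; rewrite !mxE.
  by case: (z 0 j) => a b /= -> ->.
rewrite -[ltRHS]addr0 ltr_leD //.
have [->|/negW/ltW //] := eqVneq (map_mx Im z) 0.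
by rewrite !mul0mx mxE.
Qed.
End NegativeEigenvalues.

(** * Directional derivatives of sums of ridge functions *)

Lemma is_derive_ridge (R : realType) (V : normedModType R) (l : V -> R)
    (g : R -> R) (dg : R) (x v : V) :
  scalar l -> is_derive (l x) 1 g dg -> is_derive x v (g \o l) (l v * dg).
Proof.
move=> lin_l gx.
(* On the line through [x] in direction [v], the function depends on the single real variable [h],
   so the one-variable chain rule applies. *)
have line : (fun h : R => (g \o l) (h *: v + x)) = g \o (fun h => h * l v + l x).
  by apply/funext => h /=; rewrite lin_l.
have dline : is_derive (0 : R) 1 (g \o (fun h => h * l v + l x)) (dg * l v).
  apply: is_derive1_comp; first by rewrite mul0r add0r.
  by apply: is_derive_eq; rewrite addr0 scaler0 add0r [_%:A]mulr1.
split; first by apply/derivable1P; rewrite line.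
rewrite mulrC -(@derive_val _ _ _ _ _ _ _ dline) -line /derive.
set g1 := (fun h : R => h^-1 *: _); set g2 := (fun h : R => h^-1 *: _).
suff -> : g1 = g2 by [].
by apply/funext => h; rewrite /g1 /g2 /= addr0 scale0r add0r [_%:A]mulr1.
Qed.

(** Serves twice: with [cos] for the gradient, then with [sin] for the Hessian. *)
Lemma derive_ridge_sum (R : realType) (V : normedModType R) n (c : R)
    (a : 'I_n -> R) (l : 'I_n -> V -> R) (g dg : R -> R) (x v : V) :
  (forall k, scalar (l k)) -> (forall t : R, is_derive t 1 g (dg t)) ->
  'D_v (fun w => c * \sum_k a k * g (l k w)) x =
  c * \sum_k a k * (l k v * dg (l k x)).
Proof.
move=> lin_l dgP.
have -> : (fun w => c * \sum_k a k * g (l k w)) =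
    c *: \sum_k (a k *: (g \o l k)).
  apply/funext => w; rewrite fctE; congr (_ * _).
  by rewrite fct_sumE; apply: eq_bigr.
have dk k : is_derive x v (a k *: (g \o l k)) (a k * (l k v * dg (l k x))).
  by apply: is_deriveZ; exact: is_derive_ridge.
have dsum := is_derive_sum dk.
exact: (@derive_val _ _ _ _ _ _ _ (is_deriveZ c dsum)).
Qed.

Lemma eq_ordS_const n (T : Type) (s : 'I_n -> T) (i j : 'I_n) :
  (forall k, s (ordS k) = s k) -> s i = s j.
Proof.
move=> sS; have n0 : (0 < n)%N by case: n i {s j sS} => // -[].
suff s0 m (lt_mn : (m < n)%N) : s (Ordinal lt_mn) = s (Ordinal n0).
  by case: i j => i lt_in [j lt_jn]; rewrite !s0.
elim: m lt_mn => [|m IHm] lt_mn; first by congr s; exact: val_inj.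
rewrite -(IHm (ltnW lt_mn)) -[RHS]sS; congr s; apply: val_inj => /=.
by rewrite modn_small.
Qed.

(** * Gradient and Hessian of the potential, and realizable increments *)

Section Kuramoto.
Variables (R : realType) (n : nat).
Implicit Types (K : R) (u v x : 'rV[R]_n) (i j k : 'I_n).

Definition increment k x : R := x 0 (ordS k) - x 0 k.

Lemma increment_scalar k : scalar (increment k).
Proof. by move=> a x y; rewrite /increment !mxE; ring. Qed.

Lemma is_derive_cos_2pi (t : R) :
  is_derive t 1 (fun y => cos (2 * pi * y)) (- (2 * pi) * sin (2 * pi * t)).
Proof.
apply: (@is_derive_eq _ _ _ _ _ _ _ (- sin (2 * pi * t) * (2 * pi))); last by ring.
apply: (@is_derive1_comp _ cos (fun y => 2 * pi * y)).
by apply: is_derive_eq; rewrite scaler1.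
Qed.

Lemma is_derive_sin_2pi (t : R) :
  is_derive t 1 (fun y => sin (2 * pi * y)) (2 * pi * cos (2 * pi * t)).
Proof.
apply: (@is_derive_eq _ _ _ _ _ _ _ (cos (2 * pi * t) * (2 * pi))); last by ring.
apply: (@is_derive1_comp _ sin (fun y => 2 * pi * y)).
by apply: is_derive_eq; rewrite scaler1.
Qed.

Lemma partial_kuramoto K j u :
  partial_derivative j (kuramoto_potential K) u =
  K * \sum_k increment k (delta_mx 0 j) * sin (2 * pi * increment k u).
Proof.
have -> : kuramoto_potential K =
    fun w : 'rV[R]_n => - (K / (2 * pi)) * \sum_k 1 * cos (2 * pi * increment k w).
  by apply/funext => w; congr (_ * _); apply: eq_bigr => k _; rewrite mul1r.
rewrite /partial_derivative.
rewrite (derive_ridge_sum _ _ _ _ increment_scalar is_derive_cos_2pi) !mulr_sumr.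
apply: eq_bigr => k _.
(* [field] unfolds [pi] and then fails to recognise it, so it is generalized. *)
by move: (lt0r_neq0 (pi_gt0 R)); move: (pi : R) => p p0; field.
Qed.

(** The signed incidence matrix of the cycle, with sites as rows and edges as columns. *)
Definition increment_mx : 'M[R]_n := \matrix_(i, k) increment k (delta_mx 0 i).

Lemma mulmx_increment_mx x : x *m increment_mx = \row_k increment k x.
Proof.
apply/rowP => k; rewrite !mxE /increment {2 3}[x]row_sum_delta !summxE -sumrB.
by apply: eq_bigr => i _; rewrite !mxE /increment !mxE; ring.
Qed.

Lemma hessian_kuramoto K u :
  hessian (kuramoto_potential K) u = (2 * pi * K) *:
    (increment_mx *m diag_mx (\row_k cos (2 * pi * increment k u)) *m increment_mx^T).
Proof.
apply/matrixP => i j; rewrite !mxE (funext (partial_kuramoto K j)).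
rewrite /partial_derivative.
rewrite (derive_ridge_sum _ _ _ _ increment_scalar is_derive_sin_2pi) !mulr_sumr.
by rewrite mul_mx_diag; apply: eq_bigr => k _; rewrite !mxE; ring.
Qed.

Lemma hessian_kuramoto_sym K u :
  (hessian (kuramoto_potential K) u)^T = hessian (kuramoto_potential K) u.
Proof.
by rewrite hessian_kuramoto linearZ /= !trmx_mul trmxK tr_diag_mx mulmxA.
Qed.

Lemma hessian_kuramoto_form K u x :
  (x *m hessian (kuramoto_potential K) u *m x^T) 0 0 =
  2 * pi * K * \sum_k cos (2 * pi * increment k u) * increment k x ^+ 2.
Proof.
rewrite hessian_kuramoto -scalemxAr -scalemxAl mxE; congr (_ * _).
rewrite !mulmxA -[_ *m increment_mx^T *m _]mulmxA -trmx_mul.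
rewrite mulmx_increment_mx mul_mx_diag mxE.
by apply: eq_bigr => k _; rewrite !mxE; ring.
Qed.

Lemma equilibrium_sin K u i j : K != 0 -> equilibrium K u ->
  sin (2 * pi * increment i u) = sin (2 * pi * increment j u).
Proof.
move=> K0 /rowP crit; pose s k := sin (2 * pi * increment k u).
have step k : s (ordS k) = s k.
  (* Only the edges [k] and [ordS k] touch the site [ordS k], so this gradient component is [K]
     times the difference of their sines. *)
  have := crit (ordS k); rewrite !mxE partial_kuramoto => /eqP.
  rewrite mulf_eq0 (negPf K0) /=.
  under eq_bigr => l _ do rewrite /increment !mxE eqxx /= mulrBl.
  rewrite sumrB (bigD1 k) //= [X in _ - X](bigD1 (ordS k)) //=.
  rewrite !eqxx !mul1r !big1.
  - by rewrite !addr0 subr_eq0 => /eqP.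
  - by move=> l /negPf ->; rewrite mul0r.
  by move=> l lk; rewrite (inj_eq (can_inj (@ordSK n))) (negPf lk) mul0r.
exact: (eq_ordS_const i j step).
Qed.

(** Partial sums of [y] have the right increments, and the zero total is what closes them up around
    the cycle. *)
Lemma ex_increment_eq (y : 'I_n -> R) : \sum_k y k = 0 ->
  exists x : 'rV[R]_n, forall k, increment k x = y k.
Proof.
move=> y0; exists (\row_i \sum_(j < n | (j < i)%N) y j) => k.
rewrite /increment !mxE /=; pose Y m := \sum_(j < n | (j < m)%N) y j.
have YS : Y k.+1 = Y k + y k.
  rewrite /Y (bigD1 k) //= addrC; congr (_ + _); apply: eq_bigl => j.
  by rewrite ltnS ltn_neqAle andbC.
have [lt_kn|le_nk] := ltnP k.+1 n.
  by rewrite modn_small // -/(Y k) -/(Y k.+1) YS addrAC subrr add0r.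
(* At the last site the successor is 0, where the partial sum is empty. *)
have nk : k.+1 = n by apply/eqP; rewrite eqn_leq ltn_ord.
have Yn : Y k.+1 = 0.
  by rewrite -[RHS]y0 /Y nk; apply: eq_bigl => j; rewrite ltn_ord.
have -> : (k.+1 %% n = 0)%N by rewrite nk modnn.
rewrite big_pred0 //; move: YS; rewrite Yn -/(Y k).
by move/eqP; rewrite eq_sym addr_eq0 => /eqP ->; rewrite add0r opprK.
Qed.
End Kuramoto.

(** * Phases on the circle and the sites with negative cosine *)

Section Phases.
Variables (R : realType).

Lemma cos_sin_2pi_int (m : int) :
  cos (2 * pi * m%:~R) = 1 :> R /\ sin (2 * pi * m%:~R) = 0 :> R.
Proof.
have nat_case (k : nat) :
    cos (2 * pi * k%:R) = 1 :> R /\ sin (2 * pi * k%:R) = 0 :> R.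
  elim: k => [|k [cosk sink]]; first by rewrite mulr0 cos0 sin0.
  have -> : 2 * pi * k.+1%:R = 2 * pi * k%:R + pi *+ 2 :> R.
    by rewrite -natr1 -[pi *+ 2]mulr_natl; ring.
  by rewrite cosD2pi sinD2pi.
case: (intP m) => [|k|k]; rewrite ?mulr0 ?cos0 ?sin0 //; first exact: nat_case.
by rewrite mulrNz mulrN cosN sinN; have [-> ->] := nat_case k.+1; rewrite oppr0.
Qed.

Lemma cos_2pi_mod1 (x : R) : cos (2 * pi * mod1 x) = cos (2 * pi * x).
Proof.
have [c1 s0] := cos_sin_2pi_int (Num.floor x).
by rewrite /mod1 mulrBr cosB c1 s0 mulr1 mulr0 addr0.
Qed.

Lemma sin_2pi_mod1 (x : R) : sin (2 * pi * mod1 x) = sin (2 * pi * x).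
Proof.
have [c1 s0] := cos_sin_2pi_int (Num.floor x).
by rewrite /mod1 mulrBr sinB c1 s0 mulr1 mulr0 subr0.
Qed.

Lemma mod1_itv (x : R) : 0 <= mod1 x < 1.
Proof.
by have := floor_itv x; rewrite /mod1 intrD; lra.
Qed.

Lemma cos_2pi_eq1 (t : R) : -1 < t < 1 -> cos (2 * pi * t) = 1 -> t = 0.
Proof.
move=> /andP[t_gtN1 t_lt1].
rewrite -mulrA mulr_natl cos_mulr2n => h.
(* [cos (2 pi t) = 1 - 2 sin (pi t) ^ 2] *)
have s0 : sin (pi * t) = 0.
  by apply/eqP; rewrite -sqrf_eq0 sin2cos2; apply/eqP; lra.
have p0 := pi_gt0 R.
have [t0|t0|//] := ltgtP t 0.
  suff : 0 < sin (pi * - t) by rewrite mulrN sinN s0 oppr0 ltxx.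
  by rewrite sin_gt0_pi //; nra.
suff : 0 < sin (pi * t) by rewrite s0 ltxx.
by rewrite sin_gt0_pi //; nra.
Qed.

(** The representatives differ by less than 1 in absolute value, and the cosine of the angle between
    them is [cos ^ 2 + sin ^ 2 = 1]. *)
Lemma mod1_inj_circle (x y : R) :
  cos (2 * pi * x) = cos (2 * pi * y) -> sin (2 * pi * x) = sin (2 * pi * y) ->
  mod1 x = mod1 y.
Proof.
rewrite -(cos_2pi_mod1 x) -(cos_2pi_mod1 y) -(sin_2pi_mod1 x) -(sin_2pi_mod1 y).
move=> eqc eqs; have := mod1_itv x; have := mod1_itv y => /andP[? ?] /andP[? ?].
apply/eqP; rewrite -subr_eq0; apply/eqP/cos_2pi_eq1; first lra.
by rewrite mulrBr cosB eqc eqs -!expr2 cos2Dsin2.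
Qed.

Lemma eq_sin_norm_cos (x y : R) : sin x = sin y -> `|cos x| = `|cos y|.
Proof.
move=> eqs; apply/eqP; rewrite -(@eqrXn2 _ 2) // !real_normK ?num_real //.
by rewrite !cos2sin2 eqs.
Qed.

Lemma kuramoto_negative_sites n (u : 'rV[R]_n) :
  let C k := cos (2 * pi * increment k u) in
  let S k := sin (2 * pi * increment k u) in
  (forall i j, S i = S j) -> (1 < n)%N -> (num_plus u <= n - 2)%N ->
  exists c : R, [/\ 0 < c, forall k, C k <= c &
    exists i j, [/\ i != j, C i = - c & C j = - c]].
Proof.
move=> C S eqS n_gt1; rewrite /num_plus; case: ifPn => [_|].
  (* If all phases agree, [num_plus u] is [n], which exceeds [n - 2]. *)
  by move=> le_n; exfalso; move: (leq_trans n_gt1 le_n); lia.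
move=> /forallPn[i /forallPn[j neq_ij]].
have phaseE k : cos (2 * pi * phase_diff u k) = C k by exact: cos_2pi_mod1.
have phase_inj k l : C k = C l -> phase_diff u k = phase_diff u l.
  by move=> eqC; apply: mod1_inj_circle => //; exact: eqS.
have [c normC] : exists c, forall k, `|C k| = c.
  by exists `|C i| => k; exact/eq_sin_norm_cos/eqS.
have CE k : C k = c \/ C k = - c.
  by rewrite -(normC k); case: (ger0P (C k)) => _; [left|right; rewrite opprK].
have neqC : C i != C j by apply: contra neq_ij => /eqP/phase_inj/eqP.
have c_gt0 : 0 < c.
  rewrite -(normC i) normr_gt0; apply: contra_neq neqC => Ci0.
  by apply/eqP; rewrite Ci0 eq_sym -normr_eq0 normC -(normC i) Ci0 normr0.
(* The default value of [main_phase] never occurs: without a positive cosine, [C i] and [C j] would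
   both be [- c]. *)
rewrite /sigma /main_phase; case: pickP => [i1|noC]; last first.
  have := noC i; have := noC j; rewrite !phaseE.
  move: neqC; case: (CE j) => ->; rewrite ?c_gt0 //.
  by case: (CE i) => ->; rewrite ?c_gt0 // eqxx.
rewrite phaseE => C1_gt0; set P := [set _ | _] => leP.
(* A site with cosine [c] shares both sine and cosine with [i1], hence its phase, and so belongs to
   [P]. *)
have CP k : k \in ~: P -> C k = - c.
  rewrite !inE => kP; case: (CE k) => // Ck; move: kP.
  by rewrite (phase_inj k i1) ?eqxx // Ck -(normC i1) gtr0_norm.
exists c; split=> // [k|]; first by rewrite -(normC k) ler_norm.
have /card_gt1P[k [l [kP lP neq_kl]]] : (1 < #|~: P|)%N.
  by have := cardsC P; rewrite card_ord; lia.
by exists k, l; rewrite neq_kl !CP.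
Qed.
End Phases.

(** * The plane of negative directions and the conclusion *)

Lemma two_negative_directions (R : realType) n (C : 'I_n -> R) (c : R)
    (i j : 'I_n) :
  (5 <= n)%N -> i != j -> 0 < c -> (forall k, C k <= c) ->
  C i = - c -> C j = - c ->
  exists W : 'M[R]_(2, n), forall v : 'rV_2, v != 0 ->
    \sum_k C k * increment k (v *m W) ^+ 2 < 0.
Proof.
move=> n_ge5 neq_ij c_gt0 Cle Ci Cj; have neq_ji : j != i by rewrite eq_sym.
have nR : (5 : R) <= n%:R by rewrite ler_nat.
(* An increment 1 at one of [i], [j] is balanced by [- w] at each of the [n - 2] other sites. *)
pose w : R := (n%:R - 2)^-1.
have wE : w * (n%:R - 2) = 1 by rewrite mulVf //; apply: lt0r_neq0; lra.
have w_gt0 : 0 < w by rewrite invr_gt0; lra.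
clearbody w.
pose others k := (k != i) && (k != j).
have split_ij (f : 'I_n -> R) : \sum_k f k = f i + f j + \sum_(k | others k) f k.
  by rewrite (bigD1 i) // (bigD1 j) //= addrA.
have sum_others (a : R) : \sum_(k | others k) a = a * (n%:R - 2).
  have := split_ij (fun=> a); rewrite sumr_const card_ord -mulr_natr /=; lra.
have ex_row (l : 'I_n) : l \in [:: i; j] -> exists x : 'rV[R]_n,
    forall k, increment k x = if others k then - w else (k == l)%:R.
  move=> lij; apply: ex_increment_eq; rewrite split_ij.
  rewrite (eq_bigr (fun=> - w)) => [|k ->//].
  rewrite sum_others mulNr wE /others !eqxx /= andbF.
  move: lij; rewrite !inE => /orP[]/eqP ->.
    by rewrite eqxx (negPf neq_ji) /=; lra.
  by rewrite eqxx (negPf neq_ij) /=; lra.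
have [|x xE] := ex_row i; first by rewrite !inE eqxx.
have [|y yE] := ex_row j; first by rewrite !inE eqxx orbT.
exists (\matrix_(r, k) if r == 0 then x 0 k else y 0 k) => v v0.
set s := v 0 0; set t := v 0 1.
(* The trailing [+ 0] gives both summands the shape [a *: x + y] required by [increment_scalar]. *)
have -> : v *m (\matrix_(r, k) if r == 0 then x 0 k else y 0 k) =
    s *: x + (t *: y + 0).
  apply/rowP => k; rewrite !mxE big_ord_recl big_ord1 !mxE /= addr0.
  by congr (_ + v 0 _ * _); exact: val_inj.
have incE k : increment k (s *: x + (t *: y + 0)) =
    if others k then - w * (s + t) else s * (k == i)%:R + t * (k == j)%:R.
  rewrite !increment_scalar xE yE /increment !mxE.
  by case: ifP => _; rewrite subrr addr0 // -mulrDl mulrC.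
have st_gt0 : 0 < s ^+ 2 + t ^+ 2.
  rewrite lt0r addr_ge0 ?sqr_ge0 // andbT; apply: contra_neq v0 => /eqP.
  rewrite paddr_eq0 ?sqr_ge0 // !sqrf_eq0 => /andP[/eqP s0 /eqP t0].
  apply/rowP => r; rewrite mxE; case: r => [[|[|//]] lt_r].
    by rewrite -[RHS]s0; congr (v 0 _); exact: val_inj.
  by rewrite -[RHS]t0; congr (v 0 _); exact: val_inj.
have others_i : others i = false by rewrite /others eqxx.
have others_j : others j = false by rewrite /others eqxx andbF.
rewrite split_ij !incE others_i others_j !eqxx.
rewrite (negPf neq_ij) (negPf neq_ji) /= !mulr0n.
have : \sum_(k | others k) C k * increment k (s *: x + (t *: y + 0)) ^+ 2
    <= c * (w * (s + t) ^+ 2).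
  have -> : c * (w * (s + t) ^+ 2) = c * (- w * (s + t)) ^+ 2 * (n%:R - 2).
    transitivity (c * (w * (n%:R - 2) * w * (s + t) ^+ 2)); last by ring.
    by rewrite wE mul1r.
  rewrite -sum_others; apply: ler_sum => k kij.
  by rewrite incE kij ler_wpM2r ?sqr_ge0.
(* Here [n >= 5] enters: [w <= 1/3], while [(s + t) ^ 2] is at most [2 (s ^ 2 + t ^ 2)], so the
   ratio is at most 2/3. *)
have : w * (s + t) ^+ 2 < s ^+ 2 + t ^+ 2.
  have : 0 <= (s - t) ^+ 2 by exact: sqr_ge0.
  have w3 : 3 * w <= 1 by rewrite -wE mulrC ler_pM2l //; lra.
  have := sqr_ge0 (s + t).
  nra.
rewrite -(ltr_pM2l c_gt0) Ci Cj; move: (\sum_(k | others k) _) => rest; lra.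
Qed.

Theorem lemma4p11 (R : realType) (n : nat) (K : R) (u : 'rV[R]_n)
    (hn : (5 <= n)%N) (hK : 0 < K)
    (hu : equilibrium K u)
    (hp : (1 <= num_plus u <= n - 2)%N) :
  (2 <= morse_index (kuramoto_potential K) u)%N.
Proof.
have [_ le_p] := andP hp.
have eq_sin i j : sin (2 * pi * increment i u) = sin (2 * pi * increment j u).
  by apply: equilibrium_sin hu; exact: lt0r_neq0.
have [|c [c_gt0 Cle [i [j [neq_ij Ci Cj]]]]] :=
  kuramoto_negative_sites eq_sin _ le_p.
  exact: leq_trans hn.
have [W negW] := two_negative_directions hn neq_ij c_gt0 Cle Ci Cj.
apply: (negative_definite_rows_le_num_neg (W := W)).
  exact: hessian_kuramoto_sym.
move=> v v0; rewrite !mulmxA -[_ *m W^T *m _]mulmxA -trmx_mul.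
rewrite hessian_kuramoto_form pmulr_rlt0 ?negW //.
by rewrite !mulr_gt0 // pi_gt0.
Qed.
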